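(* Let $S$ be a (connected) oriented closed surface with a cellular decomposition $\mathcal{D}$ and a weight $\Phi:E\to(0,\pi)$. In the hyperbolic background geometry, the image $\mathbf{K}(\mathbb{R}^N_{>0})$ of the curvature map satisfies $$\prod_{i\in V}\Big(2\pi-\mathcal{L}(\mathcal{D},\Phi)_i,\;2\pi\Big)\subset\mathbf{K}\big(\mathbb{R}^N_{>0}\big)$$ and $$\prod_{i\in V}\Big(-\infty,\;2\pi-\mathcal{L}(\mathcal{D},\Phi)_i\Big]\cap\mathbf{K}\big(\mathbb{R}^N_{>0}\big)=\emptyset.$$
   Context: $V=\{v_1,\dots,v_N\}$ and $E$ are the vertices and edges of $\mathcal{D}$; $\Phi_{ij}$ is the value of $\Phi$ on the edge $e_{ij}$ joining $v_i,v_j$. Sums $\sum_{j\sim i}$ run over the neighbours of $i$, i.e. over the edges at $i$ (one term for each edge-end at $v_i$). The character at $i$ is $\mathcal{L}(\mathcal{D},\Phi)_i=\sum_{j\sim i}\Phi_{ij}$. For a radius vector $r=(r_1,\dots,r_N)\in\mathbb{R}^N_{>0}$ and an edge $e_{ij}$, consider in the hyperbolic plane the triangle whose vertices are the centers $i,j$ of two circles of radii $r_i,r_j$ meeting with exterior intersection angle $\Phi_{ij}$ and one of the intersection points of the two circles. Its sides have lengths $r_i$ (from $i$ to the intersection point), $r_j$ (from $j$ to the intersection point) and $l_{ij}=\cosh^{-1}(\cosh r_i\cosh r_j+\sinh r_i\sinh r_j\cos\Phi_{ij})$. Let $\theta_i^j=\theta_i^j(r_i,r_j)\in(0,\pi)$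 be its inner angle at the center $i$. The vertex curvature is $K_i(r)=2\pi-2\sum_{j\sim i}\theta_i^j$, and the curvature map is $\mathbf{K}:\mathbb{R}^N_{>0}\to\mathbb{R}^N$, $r\mapsto(K_1(r),\dots,K_N(r))$.
   Formalization: The cellular decomposition is required to have at least one edge; this excludes only the sphere with one vertex, one face and no edges, where L = 0 and K = 2π, so the second (emptiness) claim fails. *)

(* Defs.v *)
From mathcomp Require Import all_boot all_order all_fingroup all_algebra.
From mathcomp Require Import ring lra.
From mathcomp Require Import all_classical all_reals all_analysis.

Set Implicit Arguments.
Unset Strict Implicit.
Unset Printing Implicit Defensive.

Import Order.TTheory GRing.Theory Num.Theory.
Local Open Scope classical_set_scope.
Local Open Scope ring_scope.

(* A cellular decomposition of a connected oriented closed surface, encoded as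
   a combinatorial map (rotation system).  A dart is an edge-end, i.e. an edge
   with a choice of one of its two ends; [opp] exchanges the two ends of an
   edge, and [rot] sends a dart to the next one around the same vertex in the
   positive sense.  Vertices, edges and faces are the orbits of [rot], [opp]
   and [face_perm] below; gluing one disc along each face orbit recovers the
   surface, which is connected iff the two permutations act transitively.
   Loops and multiple edges are allowed.  [dart_gt0] rules out only the
   decomposition of the sphere into one vertex and one face, which has no
   edge. *)
Record cellular_decomposition := CellularDecomposition {
  dart : finType;
  rot : {perm dart};
  opp : {perm dart};
  oppK : involutive opp;
  opp_neq : forall d, opp d != d;
  dart_gt0 : (0 < #|dart|)%N;
  map_connected : forall d d' : dart,
    connect (fun x y => (y == rot x) || (y == opp x)) d d'
}.

Lemma mem_porbits (T : finType) (s : {perm T}) x : porbit s x \in porbits s.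
Proof. exact: imset_f. Qed.

Section Cells.
Variable D : cellular_decomposition.

Definition face_perm : {perm dart D} := (opp D * rot D)%g.

Definition vertex : finType := {v : {set dart D} | v \in porbits (rot D)}.
Definition edge : finType := {e : {set dart D} | e \in porbits (opp D)}.
Definition face : finType := {f : {set dart D} | f \in porbits face_perm}.

Definition vertex_of (d : dart D) : vertex :=
  exist _ (porbit (rot D) d) (mem_porbits (rot D) d).
Definition edge_of (d : dart D) : edge :=
  exist _ (porbit (opp D) d) (mem_porbits (opp D) d).

End Cells.

Section Hyperbolic.
Variable R : realType.
Implicit Types (x y phi : R) (p q s : 'rV[R]_3).

Definition cosh x : R := (expR x + expR (- x)) / 2.
Definition sinh x : R := (expR x - expR (- x)) / 2.

(* The inverse of [cosh : [0, +oo[ -> [1, +oo[]. *)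
Definition arcosh x : R := ln (x + Num.sqrt (x ^+ 2 - 1)).

(* The hyperbolic plane is taken in the hyperboloid model, in Minkowski space
   of signature (-, +, +). *)
Definition mink p q : R :=
  - (p 0 0 * q 0 0) + p 0 1 * q 0 1 + p 0 2%:R * q 0 2%:R.

Definition hplane : set 'rV[R]_3 := [set p | mink p p = -1 /\ 0 < p 0 0].

Definition hdist p q : R := arcosh (- mink p q).

(* For [p], [q] in [hplane], the component of [q] tangent to [hplane] at [p]:
   the initial direction of the geodesic from [p] to [q]. *)
Definition hdir p q : 'rV[R]_3 := q + mink p q *: p.

Definition hangle p q s : R :=
  let u := hdir p q in let v := hdir p s in
  acos (mink u v / (Num.sqrt (mink u u) * Num.sqrt (mink v v))).

Definition edge_length (ri rj phi : R) : R :=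
  arcosh (cosh ri * cosh rj + sinh ri * sinh rj * cos phi).

(* [A], [B] are the centers [i], [j] and [X] is an intersection point of the
   two circles. *)
Definition circle_triangle (ri rj phi : R) (A B X : 'rV[R]_3) : Prop :=
  [/\ [/\ hplane A, hplane B & hplane X], hdist A X = ri, hdist B X = rj
    & hdist A B = edge_length ri rj phi].

(* See [circle_triangle_exists] and [thetaE]: the triangle exists and the
   angle does not depend on its position. *)
Definition theta (ri rj phi : R) : R :=
  xget 0 [set t | exists A B X,
    circle_triangle ri rj phi A B X /\ t = hangle A B X].

Lemma cosh2_sinh2 x : cosh x ^+ 2 = 1 + sinh x ^+ 2.
Proof.
have e : expR x * expR (- x) = 1 by rewrite -expRD subrr expR0.
rewrite /cosh /sinh; move: e; set a := expR x; set b := expR _ => e.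
suff -> : ((a + b) / 2) ^+ 2 = a * b + ((a - b) / 2) ^+ 2 by rewrite e.
by field.
Qed.

Lemma sinh_gt0 x : 0 < x -> 0 < sinh x.
Proof.
by move=> x0; rewrite /sinh divr_gt0 // subr_gt0 ltr_expR; lra.
Qed.

Lemma sinh_ge0 x : 0 <= x -> 0 <= sinh x.
Proof.
by move=> x0; rewrite /sinh divr_ge0 // subr_ge0 ler_expR; lra.
Qed.

Lemma cosh_gt0 x : 0 < cosh x.
Proof. by rewrite /cosh divr_gt0 // addr_gt0 // expR_gt0. Qed.

Lemma cosh_ge1 x : 1 <= cosh x.
Proof.
have := cosh2_sinh2 x; have := cosh_gt0 x; have := sqr_ge0 (sinh x).
nra.
Qed.

Lemma cosh_arcosh x : 1 <= x -> cosh (arcosh x) = x.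
Proof.
move=> x1; rewrite /cosh /arcosh; set w := Num.sqrt _.
have w0 : 0 <= w by exact: sqrtr_ge0.
have w2 : w ^+ 2 = x ^+ 2 - 1 by rewrite sqr_sqrtr //; nra.
have xw : 0 < x + w by lra.
rewrite expRN lnK ?posrE //.
have -> : (x + w)^-1 = x - w.
  apply: (mulfI (lt0r_neq0 xw)); rewrite divff ?lt0r_neq0 //.
  rewrite -[LHS](subrK (x ^+ 2)) -[1](opprK 1) -opprB opprK; nra.
lra.
Qed.

Lemma arcosh_cosh x : 0 <= x -> arcosh (cosh x) = x.
Proof.
move=> x0; rewrite /arcosh cosh2_sinh2 addrAC subrr add0r sqrtr_sqr.
rewrite ger0_norm ?sinh_ge0 //.
have -> : cosh x + sinh x = expR x by rewrite /cosh /sinh; lra.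
exact: expRK.
Qed.

Lemma mink_le_N1 p q : hplane p -> hplane q -> 1 <= - mink p q.
Proof.
rewrite /hplane /= /mink.
move: (p 0 0) (p 0 1) (p 0 2%:R) (q 0 0) (q 0 1) (q 0 2%:R).
move=> a0 a1 a2 b0 b1 b2 [ha a0p] [hb b0p].
have [neg|pos] := leP (1 + (a1 * b1 + a2 * b2)) 0; first by nra.
suff : 1 + (a1 * b1 + a2 * b2) <= a0 * b0 by lra.
have ab0 : 0 <= a0 * b0 by nra.
rewrite -ler_sqr ?nnegrE ?(ltW pos) // exprMn.
have -> : a0 ^+ 2 = 1 + a1 ^+ 2 + a2 ^+ 2 by lra.
have -> : b0 ^+ 2 = 1 + b1 ^+ 2 + b2 ^+ 2 by lra.
rewrite -subr_ge0.
rewrite (_ : _ - _ = (a1 - b1) ^+ 2 + (a2 - b2) ^+ 2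
  + (a1 * b2 - a2 * b1) ^+ 2); last by ring.
by rewrite !addr_ge0 ?sqr_ge0.
Qed.

Lemma minkE p q : hplane p -> hplane q -> mink p q = - cosh (hdist p q).
Proof. by move=> hp hq; rewrite cosh_arcosh ?opprK ?mink_le_N1. Qed.

Lemma minkC p q : mink p q = mink q p.
Proof. by rewrite /mink; ring. Qed.

Lemma mink_hdir p q s : mink p p = -1 ->
  mink (hdir p q) (hdir p s) = mink q s + mink p q * mink p s.
Proof.
move=> pp; suff -> : mink (hdir p q) (hdir p s) =
  mink q s + mink p q * mink p s * (2 + mink p p) by rewrite pp; ring.
by rewrite /hdir /mink !mxE; ring.
Qed.

Lemma circle_triangle_exists (ri rj phi : R) : 0 <= ri -> 0 <= rj ->
  exists A B X, circle_triangle ri rj phi A B X.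
Proof.
move=> ri0 rj0; pose pt (a b c : R) : 'rV[R]_3 :=
  \row_(k < 3) (if k == 0 then a else if k == 1 then b else c).
have mpt a b c a' b' c' :
    mink (pt a b c) (pt a' b' c') = - (a * a') + b * b' + c * c'.
  by rewrite /mink /pt !mxE.
have cA := cosh2_sinh2 ri; have cB := cosh2_sinh2 rj.
have cs := cos2Dsin2 phi.
exists (pt (cosh ri) (sinh ri) 0).
exists (pt (cosh rj) (- sinh rj * cos phi) (sinh rj * sin phi)).
exists (pt 1 0 0).
have pt0 a b c : pt a b c 0 0 = a by rewrite /pt mxE.
split; [split; split | | |]; rewrite ?pt0 ?cosh_gt0 ?ltr01 // /hdist ?mpt.
- by rewrite -!expr2 cA; ring.
- rewrite (_ : _ + _ = - cosh rj ^+ 2 + sinh rj ^+ 2 *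
    (cos phi ^+ 2 + sin phi ^+ 2)); last by ring.
  by rewrite cs cB; ring.
- by ring.
- rewrite -[RHS]arcosh_cosh //; congr arcosh; ring.
- rewrite -[RHS]arcosh_cosh //; congr arcosh; ring.
- rewrite /edge_length; congr arcosh; ring.
Qed.

Lemma cosh_edge_length (ri rj phi : R) : 0 <= ri -> 0 <= rj ->
  cosh (edge_length ri rj phi) =
  cosh ri * cosh rj + sinh ri * sinh rj * cos phi.
Proof.
move=> ri0 rj0; rewrite cosh_arcosh //.
have s0 : 0 <= sinh ri * sinh rj by rewrite mulr_ge0 ?sinh_ge0.
have cN := cos_geN1 phi.
suff : 1 + sinh ri * sinh rj <= cosh ri * cosh rj by nra.
have cc : 0 <= cosh ri * cosh rj by rewrite ltW // mulr_gt0 ?cosh_gt0.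
rewrite -ler_sqr ?nnegrE ?addr_ge0 // exprMn !cosh2_sinh2.
have := sqr_ge0 (sinh ri - sinh rj); nra.
Qed.

(* The hyperbolic law of cosines. *)
Lemma hangleE (ri rj phi : R) A B X :
  circle_triangle ri rj phi A B X ->
  let l := edge_length ri rj phi in
  hangle A B X = acos ((cosh ri * cosh l - cosh rj) /
    (Num.sqrt (cosh l ^+ 2 - 1) * Num.sqrt (cosh ri ^+ 2 - 1))).
Proof.
case=> -[hA hB hX] <- <- /= <-; rewrite /hangle.
have [AA BB XX] := And3 hA.1 hB.1 hX.1.
rewrite !mink_hdir // BB XX !minkE //.
by congr (acos (_ / (Num.sqrt _ * Num.sqrt _))); ring.
Qed.

Lemma thetaE (ri rj phi : R) A B X :
  circle_triangle ri rj phi A B X -> theta ri rj phi = hangle A B X.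
Proof.
move=> T; rewrite /theta; case: xgetP => [_ -> [A' [B' [X' [T' ->]]]]|noT].
  by rewrite (hangleE T) (hangleE T').
by case: (noT (hangle A B X)); exists A, B, X.
Qed.

Lemma theta_itv (ri rj phi : R) : 0 < ri -> 0 < rj -> 0 < phi < pi ->
  0 < theta ri rj phi < pi.
Proof.
move=> ri0 rj0 phi0.
have [A [B [X T]]] := circle_triangle_exists phi (ltW ri0) (ltW rj0).
rewrite (thetaE T) (hangleE T) cosh_edge_length ?ltW //.
have sp : 0 < sin phi by apply: sin_gt0_pi.
have := cos2Dsin2 phi; have := cosh2_sinh2 ri; have := cosh2_sinh2 rj.
have := sinh_gt0 ri0; have := sinh_gt0 rj0.
move: (cosh ri) (cosh rj) (sinh ri) (sinh rj) (cos phi) (sin phi) sp.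
move=> a b sa sb c s s0 sb0 sa0 hb ha hc.
pose m := sa * b + a * sb * c; set C := a * b + sa * sb * c.
have hC : C ^+ 2 - 1 = m ^+ 2 + (sb * s) ^+ 2.
  have -> : (sb * s) ^+ 2 = sb ^+ 2 * (1 - c ^+ 2) by rewrite -hc; ring.
  rewrite (_ : C ^+ 2 = a ^+ 2 * b ^+ 2 + sa ^+ 2 * sb ^+ 2 * c ^+ 2
    + 2 * (a * b * sa * sb * c)); last by rewrite /C; ring.
  rewrite (_ : m ^+ 2 = sa ^+ 2 * b ^+ 2 + a ^+ 2 * sb ^+ 2 * c ^+ 2
    + 2 * (a * b * sa * sb * c)); last by rewrite /m; ring.
  by rewrite ha hb; ring.
have -> : a * C - b = sa * m.
  rewrite (_ : _ - _ = a ^+ 2 * b - b + sa * (a * sb * c)); last first.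
    by rewrite /C; ring.
  by rewrite ha /m; ring.
rewrite hC ha addrAC subrr add0r sqrtr_sqr gtr0_norm //.
set w := Num.sqrt _.
have ss : 0 < (sb * s) ^+ 2 by rewrite exprn_gt0 ?mulr_gt0.
have w2 : w ^+ 2 = m ^+ 2 + (sb * s) ^+ 2.
  by rewrite sqr_sqrtr // addr_ge0 ?sqr_ge0.
have w0 : 0 < w by rewrite sqrtr_gt0 ltr_wpDl ?sqr_ge0.
have -> : sa * m / (w * sa) = m / w by field; rewrite !lt0r_neq0.
have mw : `|m| < w.
  by rewrite -ltr_sqr ?nnegrE ?(ltW w0) // real_normK ?num_real // w2; lra.
have : `|m / w| < 1 by rewrite normf_div (gtr0_norm w0) ltr_pdivrMr ?mul1r.
by rewrite ltr_norml => /andP[l u]; rewrite acos_gt0 ?acos_ltpi // ?l ?u ltW.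
Qed.

(* The two radii meet at angle [pi - phi], i.e. the circles have exterior
   intersection angle [phi]. *)
Lemma hangle_apex (ri rj phi : R) A B X : 0 < ri -> 0 < rj -> 0 <= phi <= pi ->
  circle_triangle ri rj phi A B X -> hangle X A B = pi - phi.
Proof.
move=> ri0 rj0 phi0 [[hA hB hX] dA dB dAB]; rewrite /hangle.
have [AA BB XX] := And3 hA.1 hB.1 hX.1.
rewrite !mink_hdir // AA BB !(minkC X) !minkE // dA dB dAB.
rewrite cosh_edge_length ?ltW // !mulrNN -!expr2 !cosh2_sinh2 !addKr.
rewrite !sqrtr_sqr !gtr0_norm ?sinh_gt0 // -[RHS]cosK; last first.
  by rewrite in_itv /=; lra.
rewrite (addrC pi) cosDpi cosN; congr acos; field.
by rewrite !lt0r_neq0 ?sinh_gt0.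
Qed.

End Hyperbolic.

Section Curvature.
Variables (R : realType) (D : cellular_decomposition) (Phi : edge D -> R).

(* Sums over the neighbours of [i] are sums over the darts at [i]: one term for
   each edge-end, so a loop contributes twice. *)
Definition character (i : vertex D) : R :=
  \sum_(d | vertex_of d == i) Phi (edge_of d).

Definition curvature (r : vertex D -> R) (i : vertex D) : R :=
  2 * pi - 2 * \sum_(d | vertex_of d == i)
    theta (r i) (r (vertex_of (opp D d))) (Phi (edge_of d)).

Definition positive_radii : set (vertex D -> R) :=
  [set r | forall i, 0 < r i].

End Curvature.

Arguments positive_radii : clear implicits.

(* Main.v *)
Require Import Defs.
From mathcomp Require Import all_boot all_order all_fingroup all_algebra.
From mathcomp Require Import ring lra.
From mathcomp Require Import all_classical all_reals all_analysis.

Set Implicit Arguments.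
Unset Strict Implicit.
Unset Printing Implicit Defensive.

Import Order.TTheory GRing.Theory Num.Theory.
Import numFieldNormedType.Exports.
Local Open Scope classical_set_scope.
Local Open Scope ring_scope.

(** The angle at the center [i] of a circle triangle grows with the other
    radius, and once the triangle is solved everything follows from that
    monotonicity.  The four-part formula of hyperbolic trigonometry reads
      [cot theta = (sinh x * coth y + cosh x * cos phi) / sin phi]
    ([thetaE_atan]), so [theta] is continuous, and nondecreasing in [y]
    because [coth] decreases ([angle_le]).  When the two radii agree it becomes
    [cot theta = cosh x * cot (phi / 2)]; hence [theta x x phi < phi / 2], with
    limits [phi / 2] as [x] tends to [0] and [0] as [x] tends to infinity.

    Write [A_i(r)] for the sum of the angles at [i], so that
    [K_i = 2 pi - 2 A_i] ([curvatureE]), and [L_i] for the character.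

    Emptiness.  At a vertex of maximal radius every neighbour is no larger, so
    every angle there is at most the one with equal radii, which is below half
    of its weight.  Thus [A_i < L_i / 2], that is [K_i > 2 pi - L_i], at that
    vertex ([exists_angle_sum_lt]).

    Existence.  One has to solve [A(r) = t] for [0 < t_i < L_i / 2].  Since
    [A_i] is nondecreasing in the radii at the vertices other than [i]
    ([le_angle_sum]), Perron's method of subsolutions applies.  By the limits above, small constant radii give [A > t]
    and large ones give [A < t]; the supremum of all radii between the two with
    [A >= t] is a solution ([monotone_system_solution]). *)

(** * Perron's method for monotone systems *)

Section MonotoneSystem.
Variables (R : realType) (V : finType).
Implicit Types (r : V -> R) (i j : V).

Definition upd r i (x : R) : V -> R := fun j => if j == i then x else r j.

Lemma updE r i : upd r i (r i) = r.
Proof. by apply/funext => j; rewrite /upd; case: eqP => // ->. Qed.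

(** The solution is the pointwise supremum [rs] of the subsolutions
    ([t <= S r]) in the box [[a, b]^V].  It is itself a subsolution: raising
    the other coordinates of a subsolution [r] to [rs] does not decrease
    [S r i], and [r i] can be taken as close to [rs i] as desired.  Nor can
    [t i < S rs i] hold: at [rs i = b] the hypothesis on the constant [b]
    forbids it, and for [rs i < b] the coordinate [i] alone could be increased
    slightly, which keeps a subsolution but exceeds the supremum. *)
Lemma monotone_system_solution (S : (V -> R) -> V -> R) (t : V -> R)
    (a b : R) :
  0 < a -> a <= b ->
  (forall r r' i, (forall j, 0 < r j <= r' j) -> r i = r' i ->
     S r i <= S r' i) ->
  (forall r i, (forall j, 0 < r j) ->
     {for r i, continuous (fun x => S (upd r i x) i)}) ->
  (forall i, t i <= S (fun=> a) i) ->
  (forall i, S (fun=> b) i < t i) ->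
  exists2 r, (forall i, 0 < r i) & forall i, S r i = t i.
Proof.
move=> a0 ab mono cont lo hi.
pose G := [set r | (forall j, a <= r j <= b) /\ forall i, t i <= S r i].
pose rs i := sup [set r i | r in G].
have Ga : G (fun=> a) by split=> // j; rewrite lexx.
have ubG i : has_ubound [set r i | r in G].
  by exists b => _ [r [rab _] <-]; case/andP: (rab i).
have leG r i : G r -> r i <= rs i.
  by move=> Gr; apply: ub_le_sup => //; exists r.
have rs_a i : a <= rs i by exact: (leG _ _ Ga).
have rs_b i : rs i <= b.
  apply: ge_sup; first by exists a, (fun=> a).
  by move=> _ [r [rab _] <-]; case/andP: (rab i).
have rs0 i : 0 < rs i by exact: lt_le_trans (rs_a i).
have cont_rs i : S (upd rs i x) i @[x --> rs i] --> S rs i.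
  have : S (upd rs i x) i @[x --> rs i] --> S (upd rs i (rs i)) i.
    exact: cont.
  by rewrite updE.
have rs_sub i : t i <= S rs i.
  rewrite leNgt; apply/negP => lt.
  have [e /= e0 He] := (nbhs_ballP _ _).1 (cvgr_lt _ (cont_rs i) _ lt).
  have [_ [r Gr <-] er] : exists2 x, [set r i | r in G] x & rs i - e < x.
    by apply: sup_gt; [exists a, (fun=> a) | rewrite ltrBlDr ltrDl].
  have := He (r i).
  rewrite /ball /= ger0_norm ?subr_ge0 ?leG // ltrBlDl -ltrBlDr.
  move=> /(_ er); rewrite ltNge => /negP; apply.
  have [rab /(_ i) tS] := Gr; apply: le_trans tS _; apply: mono => [j|].
    rewrite (lt_le_trans a0) /=; last by case/andP: (rab j).
    by rewrite /upd; case: eqP => [->//|_]; exact: leG.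
  by rewrite /upd eqxx.
exists rs => // i; apply/eqP; rewrite eq_le rs_sub andbT leNgt.
apply/negP => lt.
have rs_lt : rs i < b.
  rewrite lt_neqAle rs_b andbT; apply/eqP => rsb.
  have := lt_trans (hi i) lt; rewrite ltNge => /negP; apply; apply: mono => // j.
  by rewrite rs0 rs_b.
have [x [[xrs xb] tSx]] :
    exists x, (rs i < x /\ x < b) /\ t i < S (upd rs i x) i.
  apply: (@filter_ex _ (rs i)^'+); near=> x; split; first split.
  - by near: x; exact: nbhs_right_gt.
  - by near: x; exact: nbhs_right_lt.
  - by near: x; exact: cvgr_gt _ (cvg_at_right_filter (cont_rs i)) _ lt.
have rs_upd j : rs j <= upd rs i x j.
  by rewrite /upd; case: eqP => // ->; exact: ltW.
have : G (upd rs i x).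
  split=> j.
    rewrite (le_trans _ (rs_upd j)) //= /upd.
    by case: eqP => // _; exact: ltW.
  have [->|ji] := eqVneq j i; first exact: ltW.
  apply: le_trans (rs_sub j) _; apply: mono; last by rewrite /upd (negbTE ji).
  by move=> k; rewrite rs0 rs_upd.
by move=> /(leG _ i); rewrite {1}/upd eqxx leNgt xrs.
Unshelve. all: by end_near. Qed.

End MonotoneSystem.

(** * The angle of a circle triangle *)

Section Angle.
Variable R : realType.
Implicit Types x y phi : R.

Lemma cos_pihalf_subr_atan c :
  cos (pi / 2 - atan c) = c / Num.sqrt (1 + c ^+ 2) :> R.
Proof.
rewrite -cosN opprB cosBpihalf -cos_atan -{2}(atanK c) /tan mulfVK // cos_atan.
by rewrite invr_neq0 // lt0r_neq0 // sqrtr_gt0 ltr_wpDr ?sqr_ge0.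
Qed.

(** The arc cotangent of the four-part formula, with the branch in [(0, pi)]
    written as [pi / 2 - atan]. *)
Definition angle x y phi : R :=
  pi / 2 - atan ((sinh x * (cosh y / sinh y) + cosh x * cos phi) / sin phi).

(** Let [a], [sa] and [b], [sb] be the hyperbolic cosine and sine of [x] and
    [y], and [C] the hyperbolic cosine of the third side.  The law of cosines
    gives [cos theta = (a * C - b) / (sqrt (C ^ 2 - 1) * sa)].  With [s] the
    sine of [phi] and [k] the claimed cotangent, [a * C - b = sa * (sb * s * k)] and
    [C ^ 2 - 1 = (sb * s) ^ 2 * (1 + k ^ 2)], so the quotient collapses to
    [k / sqrt (1 + k ^ 2)], the cosine of the arc cotangent of [k]. *)
Lemma thetaE_atan x y phi : 0 < x -> 0 < y -> 0 < phi < pi ->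
  theta x y phi = angle x y phi.
Proof.
move=> x0 y0 phi0.
have [A [B [X T]]] := circle_triangle_exists phi (ltW x0) (ltW y0).
rewrite (thetaE T) (hangleE T) cosh_edge_length ?ltW // /angle.
have s0 : 0 < sin phi by apply: sin_gt0_pi.
have := cos2Dsin2 phi; have := cosh2_sinh2 x; have := cosh2_sinh2 y.
have := sinh_gt0 x0; have := sinh_gt0 y0.
move: (cosh x) (cosh y) (sinh x) (sinh y) (cos phi) (sin phi) s0.
move=> a b sa sb c s s0 sb0 sa0 hb ha hc.
set C := a * b + sa * sb * c; set k := _ / s.
have sb_neq0 := lt0r_neq0 sb0; have s_neq0 := lt0r_neq0 s0.
have mE : sb * s * k = sa * b + a * sb * c by rewrite /k; field; rewrite s_neq0.
have hC : C ^+ 2 - 1 = (sb * s) ^+ 2 * (1 + k ^+ 2).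
  rewrite mulrDr -exprMn mE mulr1.
  have -> : (sb * s) ^+ 2 = sb ^+ 2 * (1 - c ^+ 2) by rewrite -hc; ring.
  have -> : C ^+ 2 = a ^+ 2 * b ^+ 2 + sa ^+ 2 * sb ^+ 2 * c ^+ 2
    + 2 * (a * b * sa * sb * c) by rewrite /C; ring.
  have -> : (sa * b + a * sb * c) ^+ 2 = sa ^+ 2 * b ^+ 2
    + a ^+ 2 * sb ^+ 2 * c ^+ 2 + 2 * (a * b * sa * sb * c) by ring.
  by rewrite ha hb; ring.
have -> : a * C - b = sa * (sb * s * k).
  rewrite mE (_ : a * C - b = a ^+ 2 * b - b + sa * (a * sb * c)); last first.
    by rewrite /C; ring.
  by rewrite ha; ring.
rewrite hC ha addrAC subrr add0r sqrtrM ?sqr_ge0 // !sqrtr_sqr.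
rewrite !gtr0_norm ?mulr_gt0 //.
have w0 : 0 < Num.sqrt (1 + k ^+ 2) by rewrite sqrtr_gt0 ltr_wpDr ?sqr_ge0.
rewrite (_ : _ / _ = cos (pi / 2 - atan k)); last first.
  rewrite cos_pihalf_subr_atan; field.
  by rewrite !lt0r_neq0.
rewrite cosK // in_itv /=.
have := atan_ltpi2 k; have := atan_gtNpi2 k; lra.
Qed.

(** [coth y - coth y' = sinh (y' - y) / (sinh y * sinh y')] is nonnegative. *)
Lemma angle_le x y y' phi : 0 < x -> 0 < y -> y <= y' -> 0 < phi < pi ->
  angle x y phi <= angle x y' phi.
Proof.
move=> x0 y0 yy' phi0; have y'0 := lt_le_trans y0 yy'.
have s0 : 0 < sin phi by apply: sin_gt0_pi.
rewrite lerD2l lerN2 le_atan // ler_pM2r ?invr_gt0 // lerD2r.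
rewrite ler_pM2l ?sinh_gt0 // ler_pdivrMr ?sinh_gt0 // mulrAC.
rewrite ler_pdivlMr ?sinh_gt0 //.
rewrite -subr_ge0.
have -> : cosh y * sinh y' - cosh y' * sinh y = sinh (y' - y).
  rewrite /cosh /sinh opprB !expRD; by field.
by rewrite sinh_ge0 // subr_ge0.
Qed.

Lemma angle_diag x phi : 0 < x ->
  angle x x phi = pi / 2 - atan (cosh x * ((1 + cos phi) / sin phi)).
Proof.
move=> x0; rewrite /angle; congr (_ - atan _).
by rewrite mulrCA divff ?lt0r_neq0 ?sinh_gt0 // mulr1; ring.
Qed.

Lemma onePcos_gt0 phi : 0 < phi < pi -> 0 < 1 + cos phi.
Proof.
move=> phi0; have s0 : 0 < sin phi by apply: sin_gt0_pi.
by have := cos2Dsin2 phi; have := cos_geN1 phi; nra.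
Qed.

Lemma cosh0 : cosh 0 = 1 :> R.
Proof. by rewrite /cosh oppr0 expR0; lra. Qed.

(** [(1 + cos phi) / sin phi = cot (phi / 2)]. *)
Lemma atan_cot_half phi : 0 < phi < pi ->
  pi / 2 - atan ((1 + cos phi) / sin phi) = phi / 2.
Proof.
move=> phi0; have s0 : 0 < sin (phi / 2) by apply: sin_gt0_pi; lra.
have c0 : 0 < cos (phi / 2) by apply: cos_gt0_pihalf; lra.
have -> : (1 + cos phi) / sin phi = tan (pi / 2 - phi / 2).
  rewrite /tan -[cos (pi / 2 - _)]cosN opprB cosBpihalf.
  rewrite -[sin (pi / 2 - _)]opprK -sinN opprB sinBpihalf opprK.
  move: s0 c0; set h := phi / 2 => s0 c0.
  have -> : phi = h *+ 2 by rewrite -mulr_natr divfK.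
  rewrite cos_mulr2n sin_mulr2n addrC subrK !mulr2n.
  move: (cos h) (sin h) c0 s0 => c s c0 s0.
  by field; rewrite !lt0r_neq0 ?addr_gt0 ?mulr_gt0.
rewrite tanK; first lra.
by rewrite in_itv /=; lra.
Qed.

Lemma continuous_sinh : continuous (@sinh R).
Proof.
move=> x; apply: cvgM; last exact: cvg_cst.
apply: cvgB; first exact: continuous_expR.
by apply: continuous_comp; [exact: continuousN | exact: continuous_expR].
Qed.

Lemma continuous_cosh : continuous (@cosh R).
Proof.
move=> x; apply: cvgM; last exact: cvg_cst.
apply: cvgD; first exact: continuous_expR.
by apply: continuous_comp; [exact: continuousN | exact: continuous_expR].
Qed.

(** Moving the second radius along with the first covers loops, whose two ends
    carry the same radius, as well as edges with a fixed opposite radius. *)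
Lemma continuous_angle x (g : R -> R) phi : 0 < g x -> {for x, continuous g} ->
  {for x, continuous (fun y => angle y (g y) phi)}.
Proof.
move=> gx0 gc; rewrite /continuous_at.
apply: cvgB; first exact: cvg_cst.
apply: continuous_cvg; first exact: continuous_atan.
apply: cvgM; last exact: cvg_cst.
apply: cvgD; last by apply: cvgM; [exact: continuous_cosh|exact: cvg_cst].
apply: cvgM; first exact: continuous_sinh.
apply: cvgM; first by apply: continuous_cvg => //; exact: continuous_cosh.
apply: cvgV; first by rewrite lt0r_neq0 ?sinh_gt0.
by apply: continuous_cvg => //; exact: continuous_sinh.
Qed.

Lemma angle_diag_lt x phi : 0 < x -> 0 < phi < pi -> angle x x phi < phi / 2.
Proof.
move=> x0 phi0; rewrite angle_diag // -(atan_cot_half phi0).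
rewrite ltrD2l ltrN2 lt_atan //.
have s0 : 0 < sin phi by apply: sin_gt0_pi.
have c1 := onePcos_gt0 phi0.
rewrite ltr_pMl ?divr_gt0 //.
by have := cosh2_sinh2 x; have := sinh_gt0 x0; have := cosh_gt0 x; nra.
Qed.

Lemma cvg_angle_diag0 phi : 0 < phi < pi ->
  angle x x phi @[x --> 0^'+] --> phi / 2.
Proof.
move=> phi0; rewrite -(atan_cot_half phi0).
apply: (@cvg_trans _
    (pi / 2 - atan (cosh x * ((1 + cos phi) / sin phi)) @[x --> 0^'+])).
  apply: near_eq_cvg; near=> x; apply/esym/angle_diag.
  by near: x; exact: nbhs_right_gt.
set c := _ / sin phi.
(* The diagonal formula is continuous across 0, where cosh is 1. *)
have -> : atan c = atan (cosh 0 * c) by rewrite cosh0 mul1r.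
apply: cvg_at_right_filter.
apply: cvgB; first exact: cvg_cst.
apply: continuous_cvg; first exact: continuous_atan.
by apply: cvgM; [exact: continuous_cosh|exact: cvg_cst].
Unshelve. all: by end_near. Qed.

Lemma cvgy_angle_diag phi : 0 < phi < pi ->
  angle x x phi @[x --> +oo] --> 0.
Proof.
move=> phi0; rewrite -(subrr (pi / 2)).
have s0 : 0 < sin phi by apply: sin_gt0_pi.
have c1 := onePcos_gt0 phi0.
apply: (@cvg_trans _
    (pi / 2 - atan (cosh x * ((1 + cos phi) / sin phi)) @[x --> +oo])).
  apply: near_eq_cvg; near=> x; apply/esym/angle_diag.
  by near: x; exact: nbhs_pinfty_gt.
apply: cvgB; first exact: cvg_cst.
apply: (@cvg_comp _ _ _ _ (@atan R) _ +oo); last exact: cvgy_atan.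
(* It suffices that cosh x >= x / 2. *)
apply/cvgryPge => A; near=> x.
rewrite -ler_pdivrMr ?divr_gt0 //.
have : 2 * (A / ((1 + cos phi) / sin phi)) <= x.
  by near: x; apply: nbhs_pinfty_ge; rewrite num_real.
have := expR_ge1Dx x; have := expR_gt0 (- x); rewrite /cosh; lra.
Unshelve. all: by end_near. Qed.

End Angle.

(** * Angle sums of a cellular decomposition *)

Section AngleSum.
Variables (R : realType) (D : cellular_decomposition) (Phi : edge D -> R).
Hypothesis Phi_itv : forall e, 0 < Phi e < pi.
Implicit Types (r : vertex D -> R) (i : vertex D).

Definition angle_sum r i : R :=
  \sum_(d | vertex_of d == i)
    angle (r i) (r (vertex_of (Defs.opp D d))) (Phi (edge_of d)).

Lemma curvatureE r i : (forall j, 0 < r j) ->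
  curvature Phi r i = 2 * pi - 2 * angle_sum r i.
Proof.
move=> r0; congr (_ - 2 * _); apply: eq_bigr => d _.
exact: thetaE_atan.
Qed.

(** At a loop both radii are [r i = r' i], so only the other edges change. *)
Lemma le_angle_sum r r' i : (forall j, 0 < r j <= r' j) -> r i = r' i ->
  angle_sum r i <= angle_sum r' i.
Proof.
move=> rr' ri; apply: ler_sum => d _; rewrite -ri.
have /andP[ri0 _] := rr' i.
by have /andP[rj0 rj] := rr' (vertex_of (Defs.opp D d)); exact: angle_le.
Qed.

Lemma continuous_angle_sum r i : (forall j, 0 < r j) ->
  {for r i, continuous (fun x => angle_sum (upd r i x) i)}.
Proof.
move=> r0; apply: cvg_big; first exact: add_continuous.
move=> d _; under eq_cvg do rewrite {1}/upd eqxx.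
rewrite {1}/upd eqxx.
apply: (continuous_angle (g := fun x => upd r i x (vertex_of (Defs.opp D d)))).
  by rewrite updE.
rewrite /upd; case: eqP => _; [exact: cvg_id | exact: cvg_cst].
Qed.

Lemma cvg_angle_sum0 i :
  angle_sum (fun=> x) i @[x --> 0^'+] --> character Phi i / 2.
Proof.
rewrite mulr_suml; apply: cvg_big; first exact: add_continuous.
by move=> d _; exact: cvg_angle_diag0.
Qed.

Lemma cvgy_angle_sum i : angle_sum (fun=> x) i @[x --> +oo] --> 0.
Proof.
rewrite [X in _ --> X](_ : 0 = \sum_(d : dart D | vertex_of d == i) 0);
  last by rewrite big1.
apply: cvg_big; first exact: add_continuous.
by move=> d _; exact: cvgy_angle_diag.
Qed.

Lemma exists_angle_sum (t : vertex D -> R) :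
  (forall i, 0 < t i < character Phi i / 2) ->
  exists2 r, (forall i, 0 < r i) & forall i, angle_sum r i = t i.
Proof.
move=> tb.
have [a [a0 ta]] : exists a, 0 < a /\ forall i, t i < angle_sum (fun=> a) i.
  apply: (@filter_ex _ 0^'+); near=> x; split.
    by near: x; exact: nbhs_right_gt.
  near: x; apply: filter_forall => i.
  have /andP[_ ti] := tb i; exact: cvgr_gt _ (@cvg_angle_sum0 i) _ ti.
have [b [ab tb']] : exists b, a <= b /\ forall i, angle_sum (fun=> b) i < t i.
  apply: (@filter_ex _ +oo); near=> x; split.
    by near: x; apply: nbhs_pinfty_ge; rewrite num_real.
  near: x; apply: filter_forall => i.
  have /andP[ti _] := tb i; exact: cvgr_lt _ (@cvgy_angle_sum i) _ ti.
apply: (monotone_system_solution a0 ab) tb' => [||i].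
- exact: le_angle_sum.
- exact: continuous_angle_sum.
- exact: ltW.
Unshelve. all: by end_near. Qed.

(** The inequality holds at a vertex of maximal radius, obtained here from a
    dart [d] maximizing the radius at its vertex: such a vertex carries the dart
    [d], which makes the sum nonempty and the inequality strict. *)
Lemma exists_angle_sum_lt r : (forall i, 0 < r i) ->
  exists i, angle_sum r i < character Phi i / 2.
Proof.
move=> r0; have /card_gt0P[d0 _] := dart_gt0 D.
have [d _ dmax] := arg_maxP (fun d => r (vertex_of d)) (isT : xpredT d0).
exists (vertex_of d); rewrite mulr_suml; apply: ltr_sum.
  by apply/hasP; exists d => //; exact: mem_index_enum.
move=> d' _; apply: le_lt_trans (angle_diag_lt (r0 (vertex_of d)) (Phi_itv _)).
by apply: angle_le => //; exact: dmax.
Qed.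

End AngleSum.

Theorem theorem1p13 (R : realType) (D : cellular_decomposition)
    (Phi : edge D -> R) (Phi_itv : forall e : edge D, Phi e \in `]0, pi[) :
  [set k : vertex D -> R |
     forall i, k i \in `]2 * pi - character Phi i, 2 * pi[ ]
    `<=` curvature Phi @` positive_radii R D
  /\
  [set k : vertex D -> R |
     forall i, k i \in `]-oo, 2 * pi - character Phi i] ]
    `&` (curvature Phi @` positive_radii R D) = set0.
Proof.
have Phi0 e : 0 < Phi e < pi by have := Phi_itv e; rewrite in_itv.
split=> [k kb|].
  have tb i : 0 < (2 * pi - k i) / 2 < character Phi i / 2.
    by have := kb i; rewrite in_itv /= => /andP[? ?]; lra.
  have [r r0 rt] := exists_angle_sum Phi0 tb.
  exists r => //; apply/funext => i.
  by rewrite curvatureE // rt; lra.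
rewrite -subset0 => k [kb [r r0 rk]].
have [i ri] := exists_angle_sum_lt Phi0 r0.
by have := kb i; rewrite -rk curvatureE // in_itv /=; lra.
Qed.
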